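(* For every integer $k\ge3$, the semiring $S_c^*(a_1\cdots a_k)$ is nonfinitely based.
   Context: An ai-semiring (additively idempotent semiring) is an algebra $(S,+,\cdot)$ with two binary operations such that $(S,+)$ is a commutative idempotent semigroup, $(S,\cdot)$ is a semigroup, and both distributive laws hold. The signature is $(+,\cdot)$, with no constants. An algebra is finitely based if all its identities follow from some finite set of identities it satisfies; otherwise it is nonfinitely based. Let $a_1,\dots,a_k$ be distinct letters. The semiring $S_c^*(a_1\cdots a_k)$ has as its nonzero elements all nonempty square-free commutative words on $\{a_1,\ldots,a_k\}$ (equivalently, nonempty subsets of $\{a_1,\dots,a_k\}$), together with an element $0$ absorbing for both addition and multiplication. For nonzero $u,v$: $u+v$ is the square-free word whose set of letters is the union of the sets of letters of $u$ and $v$; $u\cdot v$ is the square-free word $uv$ if $u$ and $v$ have no letter in common, and $u\cdot v=0$ otherwise. *)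

(* Defs.v *)
From Stdlib Require List.
From mathcomp Require Import all_boot.

Set Implicit Arguments.
Unset Strict Implicit.
Unset Printing Implicit Defensive.

Record ai_semiring := AiSemiring {
  carrier :> Type;
  sadd : carrier -> carrier -> carrier;
  smul : carrier -> carrier -> carrier;
  saddA : associative sadd;
  saddC : commutative sadd;
  saddxx : idempotent_op sadd;
  smulA : associative smul;
  smulDl : left_distributive smul sadd;
  smulDr : right_distributive smul sadd
}.

(* Terms over countably many variables; the signature has no constants. *)
Inductive term : Type :=
| Var of nat
| Add of term & term
| Mul of term & term.

Definition identity : Type := (term * term)%type.

Fixpoint eval (S : ai_semiring) (rho : nat -> S) (t : term) : S :=
  match t with
  | Var i => rho i
  | Add t1 t2 => sadd (eval rho t1) (eval rho t2)
  | Mul t1 t2 => smul (eval rho t1) (eval rho t2)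
  end.

Definition satisfies (S : ai_semiring) (e : identity) : Prop :=
  forall rho : nat -> S, eval rho e.1 = eval rho e.2.

Fixpoint subst (sigma : nat -> term) (t : term) : term :=
  match t with
  | Var i => sigma i
  | Add t1 t2 => Add (subst sigma t1) (subst sigma t2)
  | Mul t1 t2 => Mul (subst sigma t1) (subst sigma t2)
  end.

(* Birkhoff's rules of equational logic. The ai-semiring axioms are not built
   in: like every other identity, they have to be derived from Sigma. *)
Inductive derivable (Sigma : seq identity) : term -> term -> Prop :=
| Der_axiom s t sigma :
    List.In (s, t) Sigma -> derivable Sigma (subst sigma s) (subst sigma t)
| Der_refl t : derivable Sigma t t
| Der_sym s t : derivable Sigma s t -> derivable Sigma t s
| Der_trans s t u :
    derivable Sigma s t -> derivable Sigma t u -> derivable Sigma s u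
| Der_add s1 t1 s2 t2 : derivable Sigma s1 t1 -> derivable Sigma s2 t2 ->
    derivable Sigma (Add s1 s2) (Add t1 t2)
| Der_mul s1 t1 s2 t2 : derivable Sigma s1 t1 -> derivable Sigma s2 t2 ->
    derivable Sigma (Mul s1 s2) (Mul t1 t2).

Definition finitely_based (S : ai_semiring) : Prop :=
  exists Sigma : seq identity,
    (forall e, List.In e Sigma -> satisfies S e) /\
    (forall e, satisfies S e -> derivable Sigma e.1 e.2).

Definition nonfinitely_based (S : ai_semiring) : Prop := ~ finitely_based S.

(* A nonempty square-free commutative word on k letters, given by its set of
   letters. *)
Definition sfword (k : nat) : Type := {w : {set 'I_k} | w != set0}.

Lemma sfunion_neq0 (k : nat) (u v : sfword k) : val u :|: val v != set0.
Proof. by rewrite setU_eq0 negb_and (valP u). Qed.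

Definition sfunion (k : nat) (u v : sfword k) : sfword k :=
  exist _ (val u :|: val v) (sfunion_neq0 u v).

Section Scstar.
Variable k : nat.

(* [None] is the absorbing element 0. *)
Definition sc_add (x y : option (sfword k)) : option (sfword k) :=
  match x, y with
  | Some u, Some v => Some (sfunion u v)
  | _, _ => None
  end.

Definition sc_mul (x y : option (sfword k)) : option (sfword k) :=
  match x, y with
  | Some u, Some v =>
      if [disjoint val u & val v] then Some (sfunion u v) else None
  | _, _ => None
  end.

Fact sc_addA : associative sc_add.
Proof.
by move=> [u|] [v|] [w|] //=; congr Some; apply: val_inj; rewrite /= setUA.
Qed.

Fact sc_addC : commutative sc_add.
Proof.
by move=> [u|] [v|] //=; congr Some; apply: val_inj; rewrite /= setUC.
Qed.

Fact sc_addxx : idempotent_op sc_add.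
Proof. by move=> [u|] //=; congr Some; apply: val_inj; rewrite /= setUid. Qed.

Fact sc_mulC : commutative sc_mul.
Proof.
move=> [u|] [v|] //=; rewrite disjoint_sym; case: ifP => // _.
by congr Some; apply: val_inj; rewrite /= setUC.
Qed.

Fact sc_mulDl : left_distributive sc_mul sc_add.
Proof.
move=> [u|] [v|] [w|] //=; last by case: ifP.
rewrite -!setI_eq0 setIUl setU_eq0.
case: eqP => _ //=; case: eqP => _ //=.
by congr Some; apply: val_inj; rewrite /= setUACA setUid.
Qed.

Fact sc_mulDr : right_distributive sc_mul sc_add.
Proof. by move=> x y z; rewrite sc_mulC sc_mulDl !(sc_mulC x). Qed.

Fact sc_mulA : associative sc_mul.
Proof.
move=> [u|] [v|] [w|] //=; rewrite -?setI_eq0; do ?by case: ifP.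
case: (boolP (val v :&: val w == set0)) => vw;
  case: (boolP (val u :&: val v == set0)) => uv //=;
  rewrite -?setI_eq0 ?setIUr ?setIUl ?setU_eq0 ?uv ?vw ?(negbTE uv)
    ?(negbTE vw) ?andbF ?andbT //=.
by case: ifP => // _; congr Some; apply: val_inj; rewrite /= setUA.
Qed.

Definition Scstar : ai_semiring :=
  AiSemiring sc_addA sc_addC sc_addxx sc_mulA sc_mulDl sc_mulDr.

End Scstar.

(* Main.v *)
(** For a graph [H], let nonempty sets of vertices and 0 form an algebra in which
    [u + v] is the union and [u * v] is the union if all vertices of [u] are
    adjacent to all vertices of [v], and 0 otherwise; for the complete graph
    [K_k] this is [Scstar k].  A term is nonzero under an assignment exactly
    when its graph of co-occurring variables is mapped into [H], so identities
    of [Scstar k] speak about [k]-colourings.  If [H] is not [k]-colourable then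
    the sum [t] of its edges satisfies [t = t * t] in [Scstar k] but not in the
    algebra of [H].  If moreover, for any at most [n] vertices of [H] and any two
    nonadjacent vertices, these vertices have a [k]-colouring in which the two
    agree, then the algebra of [H] satisfies all identities of [Scstar k] with at
    most [n] variables.  For [k = 3] such graphs are the non-3-colourable
    generalized Mycielskians of long odd cycles, whose small subgraphs are
    bipartite; cones increase [k]. *)
Require Import Defs.
From mathcomp Require Import all_boot.
From mathcomp Require Import ssralg ssrint zmodp zify.

Set Implicit Arguments.
Unset Strict Implicit.
Unset Printing Implicit Defensive.

(** * Co-occurrence graphs of terms *)

Fixpoint vars (t : term) : seq nat :=
  match t with
  | Var i => [:: i]
  | Add t1 t2 | Mul t1 t2 => vars t1 ++ vars t2
  end.

(** A variable occurring in both factors of a product gives a loop, which no proper colouring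
    allows. *)
Fixpoint edges (t : term) : seq (nat * nat) :=
  match t with
  | Var _ => [::]
  | Add t1 t2 => edges t1 ++ edges t2
  | Mul t1 t2 => edges t1 ++ edges t2 ++ [seq (x, y) | x <- vars t1, y <- vars t2]
  end.

Lemma edges_vars t x y : (x, y) \in edges t -> (x \in vars t) && (y \in vars t).
Proof.
elim: t => [//|t1 IH1 t2 IH2|t1 IH1 t2 IH2] /=; rewrite !mem_cat.
  by case/orP=> [/IH1|/IH2] /andP[-> ->]; rewrite ?orbT.
case/or3P=> [/IH1|/IH2|/allpairsP[p [t1p t2p [-> ->]]]].
- by case/andP=> -> ->.
- by case/andP=> -> ->; rewrite !orbT.
- by rewrite t1p t2p orbT.
Qed.

(** * The algebra of a graph *)

Section GraphAlgebra.
Variables (V : finType) (E : rel V).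
Implicit Types (u v : {set V}) (rho : nat -> option {set V}).

Definition joined u v := [forall a in u, [forall b in v, E a b]].

Definition gadd (x y : option {set V}) : option {set V} :=
  if (x, y) is (Some u, Some v) then Some (u :|: v) else None.

Definition gmul (x y : option {set V}) : option {set V} :=
  if (x, y) is (Some u, Some v) then
    if joined u v then Some (u :|: v) else None
  else None.

Fixpoint geval rho (t : term) : option {set V} :=
  match t with
  | Var i => rho i
  | Add t1 t2 => gadd (geval rho t1) (geval rho t2)
  | Mul t1 t2 => gmul (geval rho t1) (geval rho t2)
  end.

Lemma joinedP u v :
  reflect (forall a b, a \in u -> b \in v -> E a b) (joined u v).
Proof.
apply: (iffP forall_inP) => [uv a b /uv /forall_inP|uv a ua]; first exact.
by apply/forall_inP => b; apply: uv.
Qed.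

Lemma mem_bigcup_seq (r : nat -> {set V}) (s : seq nat) a :
  (a \in \bigcup_(x <- s) r x) = has (fun x => a \in r x) s.
Proof. by elim: s => [|x s IHs]; rewrite ?big_nil ?big_cons !inE //= IHs. Qed.

Lemma joined_bigcup (r : nat -> {set V}) (s1 s2 : seq nat) :
  joined (\bigcup_(x <- s1) r x) (\bigcup_(x <- s2) r x) =
  all (fun e => joined (r e.1) (r e.2)) [seq (x, y) | x <- s1, y <- s2].
Proof.
apply/joinedP/all_allpairsP => /= [J x y s1x s2y | J a b].
  apply/joinedP => a b xa yb.
  by apply: J; rewrite mem_bigcup_seq; apply/hasP; [exists x|exists y].
rewrite !mem_bigcup_seq => /hasP[x s1x xa] /hasP[y s2y yb].
exact: (joinedP _ _ (J _ _ s1x s2y)).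
Qed.

Definition nonzero rho (t : term) :=
  all (fun x => rho x : bool) (vars t) &&
  all (fun e => joined (odflt set0 (rho e.1)) (odflt set0 (rho e.2))) (edges t).

(** By [joined_bigcup], two unions are joined exactly when all their members are, so being nonzero
    is a condition on the single edges of the term. *)
Lemma gevalE rho t :
  geval rho t =
  if nonzero rho t then Some (\bigcup_(x <- vars t) odflt set0 (rho x))
  else None.
Proof.
rewrite /nonzero.
elim: t => [i|t1 IH1 t2 IH2|t1 IH1 t2 IH2] /=.
- by rewrite big_seq1; case: (rho i).
- rewrite IH1 IH2 !all_cat andbACA /gadd big_cat.
  by do 2!case: (all _ (vars _) && _).
- rewrite IH1 IH2 !all_cat -(joined_bigcup (odflt set0 \o rho)) big_cat /gmul.
  rewrite andbACA (andbA (all _ (vars t2))).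
  by do 2!case: (all _ (vars _) && _) => //=.
Qed.

Lemma geval_isSome rho t : geval rho t = nonzero rho t :> bool.
Proof. by rewrite gevalE; case: ifP. Qed.

Lemma geval_neq0 rho t :
  (forall x, rho x != Some set0) -> geval rho t != Some set0.
Proof.
move=> rho0; elim: t => [//|t1 IH1 t2 IH2|t1 IH1 t2 IH2] /=.
all: rewrite /gadd /gmul; case: (geval rho t1) IH1 => [u|//] u0.
all: case: (geval rho t2) => [v|//]; try case: ifP => // _.
all: by apply: contraNneq u0 => -[/eqP]; rewrite setU_eq0 => /andP[/eqP-> _].
Qed.

Lemma geval_subst rho sigma t :
  geval rho (subst sigma t) = geval (geval rho \o sigma) t.
Proof. by elim: t => [//|t1 /= -> t2 -> //|t1 /= -> t2 -> //]. Qed.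

(** The empty set is excluded through the assignments instead of the carrier; [geval_neq0] shows
    that substitution preserves this. *)
Definition gsatisfies (s t : term) : Prop :=
  forall rho, (forall x, rho x != Some set0) -> geval rho s = geval rho t.

Lemma derivable_gsatisfies (Sigma : seq identity) s t :
  (forall e, List.In e Sigma -> gsatisfies e.1 e.2) ->
  derivable Sigma s t -> gsatisfies s t.
Proof.
move=> sound; elim=> {s t}.
- move=> s t sigma /sound /= st rho rho0; rewrite !geval_subst; apply: st.
  by move=> x; apply: geval_neq0.
- by move=> t rho.
- by move=> s t _ IH rho rho0; rewrite IH.
- by move=> s t u _ IH1 _ IH2 rho rho0; rewrite IH1 // IH2.
- by move=> s1 t1 s2 t2 _ IH1 _ IH2 rho rho0 /=; rewrite IH1 // IH2.
- by move=> s1 t1 s2 t2 _ IH1 _ IH2 rho rho0 /=; rewrite IH1 // IH2.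
Qed.

End GraphAlgebra.

(** * [Scstar k] as the algebra of the complete graph *)

Lemma disjoint_joined k (u v : {set 'I_k}) :
  [disjoint u & v] = joined (fun a b => a != b) u v.
Proof.
rewrite disjoint_subset; apply/subsetP/joinedP => [uv a b /uv|uv a ua].
  by rewrite inE => av; apply: contraTneq => <-.
by rewrite inE; apply/negP => /(uv _ _ ua); rewrite eqxx.
Qed.

Lemma eval_Scstar k (rho : nat -> Scstar k) t :
  omap val (eval rho t) =
  geval (fun a b => a != b) (fun x => omap val (rho x)) t.
Proof.
elim: t => [//|t1 /= <- t2 <-|t1 /= <- t2 <-].
  by case: (eval rho t1) => // u; case: (eval rho t2).
case: (eval rho t1) => // u; case: (eval rho t2) => // v.
by rewrite /gmul /= -disjoint_joined; case: ifP.
Qed.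

Lemma satisfies_Scstar k s t :
  satisfies (Scstar k) (s, t) <-> gsatisfies (fun a b : 'I_k => a != b) s t.
Proof.
split=> st rho.
  move=> rho0; pose rho' x : Scstar k := obind insub (rho x).
  have rhoE : omap val \o rho' =1 rho.
    move=> x; rewrite /rho' /=; have := rho0 x; case: (rho x) => //= u.
    by case: insubP => //= [v _ -> //|]; rewrite negbK => /eqP->; rewrite eqxx.
  have eval_rho' t' : geval (fun a b => a != b) rho t' = omap val (eval rho' t').
    rewrite eval_Scstar; elim: t' => [x|t1 /= -> t2 -> //|t1 /= -> t2 -> //] /=.
    by rewrite -rhoE.
  by rewrite !eval_rho' (st rho').
apply: (can_inj (f := omap val) (g := obind insub)).
  by case=> //= u; rewrite valK.
rewrite !eval_Scstar; apply: st => x; case: (rho x) => //= u.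
by apply: contra_neq (valP u) => -[].
Qed.

Definition proper (T : eqType) (c : nat -> T) t :=
  all (fun e => c e.1 != c e.2) (edges t).

(** Variables outside [P] go to 0, so one assignment tests both the variables of a term and a
    colouring of them. *)
Definition point k (P : pred nat) (c : nat -> 'I_k) x :=
  if P x then Some [set c x] else None.

Lemma point_neq0 k P (c : nat -> 'I_k) x : point P c x != Some set0.
Proof.
rewrite /point; case: ifP => // _.
by apply/eqP => -[/eqP]; rewrite -cards_eq0 cards1.
Qed.

Lemma nonzero_point k P (c : nat -> 'I_k) t :
  nonzero (fun a b => a != b) (point P c) t = all P (vars t) && proper c t.
Proof.
rewrite /nonzero /point.
rewrite (@eq_all _ _ P) => [|x]; last by case: (P x).
case: allP => //= Pt; apply: eq_in_all => -[x y] /= /edges_vars/andP[tx ty].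
rewrite !Pt //=; apply/joinedP/idP => [|cxy a b]; first by apply; rewrite inE.
by rewrite !inE => /eqP-> /eqP->.
Qed.

(** * Local colourability and the transfer of identities *)

Section Colouring.
Variables (V : finType) (E : rel V).

Definition colourable k := exists c : V -> 'I_k, forall a b, E a b -> c a != c b.

Definition locally_colourable n k :=
  forall (F : seq V) (a b : V), size F <= n -> ~~ E a b ->
  exists c : V -> 'I_k,
    c a = c b /\ {in F &, forall p q, E p q -> c p != c q}.

Hypothesis Eirr : irreflexive E.

(** Choosing one vertex in the value of each variable of [s] and colouring these vertices gives a
    proper colouring of [s], hence of [t]. If an edge of [t] failed, its two variables could be
    given nonadjacent vertices of equal colour. *)
Lemma locally_colourable_gsatisfies_half n k s t (rho : nat -> option {set V}) :
  locally_colourable n k -> size (vars s) <= n ->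
  gsatisfies (fun a b : 'I_k => a != b) s t ->
  (forall x, rho x != Some set0) -> nonzero E rho s ->
  vars s =i vars t /\ nonzero E rho t.
Proof.
move=> Eloc size_s st rho0 /andP[/allP rho_s /allP join_s].
have st_proper P (c : nat -> 'I_k) :
    all P (vars s) && proper c s = all P (vars t) && proper c t.
  by rewrite -!nonzero_point -!geval_isSome st // => x; apply: point_neq0.
set r := fun x => odflt set0 (rho x).
have r_neq0 x : x \in vars s -> exists a, a \in r x.
  move=> /rho_s; rewrite /r; have := rho0 x; case: (rho x) => //= u.
  by move=> u0 _; apply/set0Pn; apply: contraNneq u0 => ->.
have [x0 sx0] : exists x, x \in vars s.
  by elim: (s) => [i|s1 [x s1x] s2 _|s1 [x s1x] s2 _] /=;
    [exists i; rewrite inE|exists x; rewrite mem_cat s1x|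
     exists x; rewrite mem_cat s1x].
have [v0 _] := r_neq0 _ sx0.
pose f x := odflt v0 [pick a in r x].
have rf x : x \in vars s -> f x \in r x.
  by move=> /r_neq0[a ra]; rewrite /f; case: pickP => // /(_ a); rewrite ra.
have colour (g : nat -> V) a b : {in vars s, forall x, g x \in r x} ->
    ~~ E a b -> exists2 c : V -> 'I_k, c a = c b & proper (c \o g) s.
  move=> rg nab; have [] := Eloc [seq g x | x <- vars s] a b _ nab.
    by rewrite size_map.
  move=> c [cab cP]; exists c => //; apply/allP => -[x y] sxy.
  have /andP[sx sy] := edges_vars sxy.
  apply: cP; rewrite ?map_f //.
  by have /joinedP := join_s _ sxy; apply; apply: rg.
have vars_st : vars s =i vars t.
  (* With [v0] taken twice, the agreement condition is void. *)
  have [c _ c_s] := colour f v0 v0 rf (negbT (Eirr v0)).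
  have := st_proper (mem (vars s)) (c \o f).
  have := st_proper (mem (vars t)) (c \o f).
  rewrite c_s !andbT.
  have -> : all (mem (vars s)) (vars s) by apply/allP.
  have -> : all (mem (vars t)) (vars t) by apply/allP.
  move=> tP /esym /andP[/allP ts c_t] x; rewrite c_t in tP.
  by apply/idP/idP => [|/ts //]; move: x; apply/allP.
split=> //; apply/andP; split; first by apply/allP => x; rewrite -vars_st => /rho_s.
apply/allP => -[x y] /= txy; have /andP[] := edges_vars txy.
rewrite -!vars_st => sx sy; apply/joinedP => a b xa yb; apply/negPn/negP => nab.
have [xy|xy] := eqVneq x y.
  have [c _ c_s] := colour f v0 v0 rf (negbT (Eirr v0)).
  have := st_proper predT (c \o f); rewrite c_s !all_predT /= => /esym/allP.
  by move=> /(_ _ txy); rewrite xy eqxx.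
(* The choice [f], changed to hit the nonadjacent pair. *)
pose g z := if z == x then a else if z == y then b else f z.
have [|c cab c_s] := colour g a b _ nab.
  move=> z sz; rewrite /g; case: eqP => [->//|_]; case: eqP => [->//|_].
  exact: rf.
have := st_proper predT (c \o g); rewrite c_s !all_predT /= => /esym/allP.
by move=> /(_ _ txy); rewrite /= /g eqxx [y == x]eq_sym (negPf xy) eqxx cab eqxx.
Qed.

Lemma locally_colourable_gsatisfies n k s t :
  locally_colourable n k -> size (vars s) <= n -> size (vars t) <= n ->
  gsatisfies (fun a b : 'I_k => a != b) s t -> gsatisfies E s t.
Proof.
move=> Eloc size_s size_t st rho rho0; rewrite !gevalE.
have ts : gsatisfies (fun a b : 'I_k => a != b) t s by move=> *; rewrite st.
have half_s := locally_colourable_gsatisfies_half Eloc size_s st rho0.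
case: ifP => [/half_s[vst ->]|nzs].
  congr Some; apply/setP => a; rewrite !mem_bigcup_seq.
  exact: eq_has_r.
case: ifP => // /(locally_colourable_gsatisfies_half Eloc size_t ts rho0)[_].
by rewrite nzs.
Qed.

Definition vertex_var (v : V) : nat := index v (enum V).

(** There is no empty sum, so the fold starts from the variable of [v0], which adds no edge. *)
Definition graph_term (v0 : V) : term :=
  foldr (fun e t => Add (Mul (Var (vertex_var e.1)) (Var (vertex_var e.2))) t)
    (Var (vertex_var v0)) [seq e <- enum {: V * V} | E e.1 e.2].

Lemma edges_graph_term v0 :
  edges (graph_term v0) =
  [seq (vertex_var e.1, vertex_var e.2) | e <- enum {: V * V} & E e.1 e.2].
Proof. by rewrite /graph_term; elim: filter => //= e l ->. Qed.

(** Both sides are always 0: under an assignment with nonzero value, picking a letter from the value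
    of each vertex variable would colour the graph. *)
Lemma graph_term_zero k v0 : 0 < k -> ~ colourable k ->
  satisfies (Scstar k) (graph_term v0, Mul (graph_term v0) (graph_term v0)).
Proof.
case: k => // k _ not_col; apply/satisfies_Scstar => rho rho0.
suff /negPf nz : ~~ nonzero (fun a b => a != b) rho (graph_term v0).
  by rewrite /= gevalE nz.
apply/negP => /andP[/allP rho_v /allP rho_e]; apply: not_col.
pose r v := odflt set0 (rho (vertex_var v)).
(* The default [ord0] is reached only at vertices without edges. *)
exists (fun v => odflt ord0 [pick i in r v]) => a b Eab.
have ab : (vertex_var a, vertex_var b) \in edges (graph_term v0).
  rewrite edges_graph_term; apply/mapP; exists (a, b) => //.
  by rewrite mem_filter mem_enum Eab.
have /joinedP rab := rho_e _ ab; have /andP[va vb] := edges_vars ab.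
have r_neq0 v : vertex_var v \in vars (graph_term v0) -> r v != set0.
  move=> /rho_v; rewrite /r; have := rho0 (vertex_var v).
  by case: (rho _) => //= u; apply: contraNneq => ->.
case: pickP => [i ri|ra]; last by have /set0Pn[?] := r_neq0 _ va; rewrite ra.
case: pickP => [j rj|rb]; last by have /set0Pn[?] := r_neq0 _ vb; rewrite rb.
exact: rab.
Qed.

(** Sending each variable to its own vertex makes the term nonzero, while its square contains a loop
    at [v0]. *)
Lemma graph_term_nonzero v0 :
  ~ gsatisfies E (graph_term v0) (Mul (graph_term v0) (graph_term v0)).
Proof.
pose rho i := Some [set nth v0 (enum V) i].
have rhoE v : nth v0 (enum V) (vertex_var v) = v by rewrite nth_index ?mem_enum.
have rho0 x : rho x != Some set0.
  by apply/eqP => -[/eqP]; rewrite -cards_eq0 cards1.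
move=> /(_ rho rho0); rewrite !gevalE.
suff -> : nonzero E rho (graph_term v0).
  case: ifP => // /andP[_ /allP] /= join_tt _.
  have tv0 : vertex_var v0 \in vars (graph_term v0).
    rewrite /graph_term; elim: filter => [|e l /=]; rewrite !inE // => ->.
    by rewrite !orbT.
  have /join_tt /joinedP /(_ v0 v0) : (vertex_var v0, vertex_var v0) \in
      edges (Mul (graph_term v0) (graph_term v0)).
    by rewrite /= !mem_cat allpairs_f ?orbT.
  by rewrite /= rhoE set11 Eirr => /(_ isT isT).
apply/andP; split; first by apply/allP.
rewrite edges_graph_term; apply/allP => e /mapP[[a b]].
rewrite mem_filter /= => /andP[Eab _] -> /=; apply/joinedP => x y.
by rewrite !rhoE !inE => /eqP-> /eqP->.
Qed.

End Colouring.

Lemma nonfinitely_based_Scstar k : 0 < k ->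
  (forall n, exists (V : finType) (E : rel V),
     [/\ irreflexive E, ~ colourable E k & locally_colourable E n k]) ->
  nonfinitely_based (Scstar k).
Proof.
move=> k_gt0 graphs [Sigma [sound complete]].
have [n nP] : exists n, forall e, List.In e Sigma ->
    size (vars e.1) <= n /\ size (vars e.2) <= n.
  elim: (Sigma) => [|e l [n IHn]]; first by exists 0.
  exists (n + size (vars e.1) + size (vars e.2)) => e' [<-|/IHn[]]; lia.
have [V [E [Eirr not_col loc_col]]] := graphs n.
have [v0 _|V0] := pickP {: V}; last first.
  by apply: not_col; exists (fun=> Ordinal k_gt0) => a; have := V0 a.
apply: (graph_term_nonzero Eirr (v0 := v0)).
apply: (derivable_gsatisfies (Sigma := Sigma)) => [[s t] st|].
  have [ns nt] := nP _ st.
  apply: (locally_colourable_gsatisfies Eirr loc_col) => //.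
  by apply/satisfies_Scstar/sound.
exact: (complete (_, _) (graph_term_zero v0 k_gt0 not_col)).
Qed.

(** * Cones and the number of colours *)

Definition cone (V : Type) (E : rel V) : rel (option V) := fun a b =>
  match a, b with
  | Some x, Some y => E x y
  | None, None => false
  | _, _ => true
  end.

Lemma cone_not_colourable (V : finType) (E : rel V) k :
  ~ colourable E k -> ~ colourable (cone E) k.+1.
Proof.
move=> not_col [c cP]; apply: not_col.
have c_lift v : {i | c (Some v) = lift (c None) i}.
  by have [i -> _] := unlift_some (cP None (Some v) isT); exists i.
exists (fun v => sval (c_lift v)) => a b Eab.
have := cP (Some a) (Some b) Eab; apply: contra_neq.
by move=> cab; rewrite (svalP (c_lift a)) (svalP (c_lift b)) cab.
Qed.

Lemma cone_locally_colourable (V : finType) (E : rel V) n k :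
  irreflexive E -> locally_colourable E n k ->
  locally_colourable (cone E) n k.+1.
Proof.
move=> Eirr Eloc F a b size_F nab.
have colour x y : ~~ E x y -> exists c : option V -> 'I_k.+1,
    c (Some x) = c (Some y) /\ {in F &, forall p q, cone E p q -> c p != c q}.
  move=> nxy; have [|c [cxy cP]] := Eloc (pmap id F) x y _ nxy.
    by rewrite size_pmap (leq_trans (count_size _ _)).
  (* The apex receives the new colour [ord0], which [lift ord0] avoids. *)
  exists (oapp (lift ord0 \o c) ord0); split; first by rewrite /= cxy.
  move=> [p|] [q|] //= Fp Fq Epq; rewrite ?(inj_eq lift_inj) //.
  by apply: cP; rewrite // mem_pmap map_id.
case: a b nab => [x|] [y|] //= nab.
  by have [c [cxy cP]] := colour x y nab; exists c.
(* Here both vertices are the apex, so any colouring of [F] will do. *)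
have [v0 _|V0] := pickP {: V}.
  by have [c [_ cP]] := colour v0 v0 (negbT (Eirr v0)); exists c.
exists (fun=> ord0); split=> //.
by move=> [p|] [q|] //; by [have := V0 p|have := V0 q].
Qed.

Lemma cone_irreflexive (V : Type) (E : rel V) :
  irreflexive E -> irreflexive (cone E).
Proof. by move=> Eirr [v|] /=. Qed.

Definition locally_bipartite (V : eqType) (E : rel V) n :=
  forall F : seq V, size F <= n ->
  exists c : V -> bool, {in F &, forall p q, E p q -> c p != c q}.

(* The third colour is spent on the two vertices that have to agree. *)
Lemma locally_bipartite_colourable (V : finType) (E : rel V) n :
  irreflexive E -> symmetric E -> locally_bipartite E n ->
  locally_colourable E n 3.
Proof.
move=> Eirr Esym Ebip F a b size_F nab; have [c cP] := Ebip F size_F.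
pose col v : 'I_3 :=
  if (v == a) || (v == b) then inord 2 else inord (c v).
exists col; split; first by rewrite /col !eqxx orbT.
move=> p q Fp Fq Epq; have := cP p q Fp Fq Epq; rewrite /col.
case: ifP => [pab|_]; case: ifP => [qab|_] => cpq.
- case/orP: pab Epq => /eqP->; case/orP: qab => /eqP->.
  all: rewrite ?Eirr ?(negPf nab) //.
  by rewrite Esym (negPf nab).
- by case: (c q); rewrite -val_eqE /= !inordK.
- by case: (c p); rewrite -val_eqE /= !inordK.
- by move: cpq; case: (c p); case: (c q) => //; rewrite -val_eqE /= !inordK.
Qed.

(** * Winding numbers of 3-colourings *)

Section WindingNumber.
Local Open Scope ring_scope.
Import GRing.Theory.
Variable N : nat.
Local Notation layer := ('Z_N -> 'I_3).
Implicit Types f g h : layer.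

Definition turn (x y : 'I_3) : int := if val y == (x.+1 %% 3)%N then 1 else -1.

Lemma turnC x y : x != y -> turn y x = - turn x y.
Proof. by case: x => [[|[|[|x]]] ?]; case: y => [[|[|[|y]]] ?]. Qed.

(* Four steps of +1 or -1 that sum to 0 modulo 3 sum to 0. *)
Lemma turn_square x y z w :
  x != y -> y != z -> z != w -> w != x -> turn x y + turn y z = turn x w + turn w z.
Proof.
by case: x => [[|[|[|x]]] ?]; case: y => [[|[|[|y]]] ?];
  case: z => [[|[|[|z]]] ?]; case: w => [[|[|[|w]]] ?].
Qed.

Definition compatible f g := forall i, f i != g (i + 1) /\ g i != f (i + 1).

(** For odd [N > 1], the zigzag [f 0, g 1, f 2, ...] closes up after [2N] steps; for compatible
    layers this sum is three times its winding number around the triangle of colours. *)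
Definition winding f g : int :=
  \sum_i (turn (f i) (g (i + 1)) + turn (g i) (f (i + 1))).

Lemma windingC f g : winding f g = winding g f.
Proof. by apply: eq_bigr => i _; rewrite addrC. Qed.

Lemma windingE f g :
  winding f g = \sum_i (turn (f i) (g (i + 1)) + turn (g (i + 1)) (f (i + 1 + 1))).
Proof.
rewrite /winding !big_split /=; congr (_ + _).
by rewrite (reindex_inj (addIr (1 : 'Z_N))).
Qed.

(** By [windingE] the walk consists of paths from [f i] over [g (i + 1)] to [f (i + 2)]; replacing
    the midpoint by [h (i + 1)] preserves the turns by [turn_square]. *)
Lemma winding_compatible f g h :
  compatible f g -> compatible f h -> winding f g = winding f h.
Proof.
move=> fg fh; rewrite !windingE; apply: eq_bigr => i _.
have [fgi _] := fg i; have [_ gfi] := fg (i + 1).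
have [fhi _] := fh i; have [_ hfi] := fh (i + 1).
by apply: turn_square => //; rewrite eq_sym.
Qed.

Lemma winding_chain (g : nat -> layer) m :
  (forall j, (j <= m)%N -> compatible (g j) (g j.+1)) ->
  winding (g 0%N) (g 1%N) = winding (g m) (g m.+1).
Proof.
elim: m => // m IHm gP; rewrite IHm => [|j jm]; last by apply: gP; lia.
rewrite windingC; apply: winding_compatible; last exact: gP.
by have gm := gP m (leqnSn m); move=> i; have [] := gm i.
Qed.

Lemma winding_const f x : (forall i, f i != x) -> winding f (fun=> x) = 0.
Proof.
move=> fx; rewrite /winding big_split /=.
have <- : \sum_i turn x (f i) = \sum_(i : 'Z_N) turn x (f (i + 1)).
  by rewrite (reindex_inj (addIr (1 : 'Z_N))).
by rewrite -big_split big1 //= => i _; rewrite (turnC (fx i)) addrN.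
Qed.

(** The value is twice a sum of [N] signs, and such a sum is odd. *)
Lemma winding_odd f : (1 < N)%N -> odd N -> winding f f != 0.
Proof.
move=> N_gt1 N_odd; pose b (i : 'Z_N) : bool := turn (f i) (f (i + 1)) != 1.
have turnE i : turn (f i) (f (i + 1)) = 1%:Z - (b i)%:Z *+ 2.
  by rewrite /b /turn; case: ifP.
have -> : winding f f = (N%:Z - (\sum_i b i)%:Z *+ 2) *+ 2.
  rewrite -[N in N%:Z](Zp_cast N_gt1) -[X in X%:Z](card_ord) -sum1_card.
  rewrite !(big_morph Posz PoszD erefl) -sumrMnl -sumrB -sumrMnl.
  by apply: eq_bigr => i _; rewrite turnE.
lia.
Qed.

End WindingNumber.

(** * Generalized Mycielskians of odd cycles *)

Section GeneralizedMycielskian.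
Import GRing.Theory.
Variable n : nat.
(** Odd, for a nonzero winding number, and above [n], so that [n] vertices miss a column. *)
Local Notation N := n.*2.+3.

(* The generalized Mycielskian of an odd cycle: [Some (i, j)] is the [i]-th
   vertex of layer [j], layer 0 is the cycle, and [None] is the apex. *)
Definition mycielskian : rel (option ('Z_N * 'I_n.+1)) := fun a b =>
  match a, b with
  | Some (i, j), Some (i', j') =>
      ((i' == i + 1)%R || (i == i' + 1)%R) &&
      [|| j' == j.+1 :> nat, j == j'.+1 :> nat |
          (j == 0 :> nat) && (j' == 0 :> nat)]
  | Some (_, j), None | None, Some (_, j) => j == n :> nat
  | None, None => false
  end.

Lemma mycielskian_irreflexive : irreflexive mycielskian.
Proof.
move=> [[i j]|] //=; rewrite orbb -subr_eq0 opprD addrA subrr sub0r oppr_eq0.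
by rewrite oner_eq0.
Qed.

Lemma mycielskian_symmetric : symmetric mycielskian.
Proof. by move=> [[i j]|] [[i' j']|] //=; rewrite orbC; congr (_ && _); lia. Qed.

(* Consecutive layers have the same winding number: it is nonzero on the odd
   cycle, and zero around the apex. *)
Lemma mycielskian_not_colourable : ~ colourable mycielskian 3.
Proof.
move=> [c cP].
(* The index is shifted: [g 0] and [g 1] are both the base cycle, because [0.-1 = 0], and [g n.+2]
   is constantly the colour of the apex. *)
pose g m (i : 'Z_N) :=
  if m <= n.+1 then c (Some (i, inord m.-1)) else c None.
have gP m : m <= n.+1 -> compatible (g m) (g m.+1).
  move=> m_le i; rewrite /g m_le ltnS.
  case: leqP => m_n; last first.
    have -> : m = n.+1 by lia.
    by split; [|rewrite eq_sym]; apply: cP; rewrite /= inordK.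
  case: m m_le m_n => [|m] m_le m_n.
    by split; apply: cP; rewrite /= eqxx ?orbT /= !inordK.
  by split; apply: cP; rewrite /= eqxx ?orbT /= !inordK ?eqxx ?orbT; lia.
have := winding_chain gP; rewrite [RHS](_ : _ = 0%R).
  apply/eqP; rewrite [X in X != _](_ : _ = winding (g 0) (g 0)) //.
  by apply: winding_odd; rewrite //= odd_double.
rewrite /g leqnn ltnn; apply: winding_const => i.
by apply: cP; rewrite /= inordK.
Qed.

(* [F] misses a layer [j0] and a column [i0]; above [j0] colour by layer, and
   below [j0] by the position of the column relative to [i0]. *)
Lemma mycielskian_locally_bipartite : locally_bipartite mycielskian n.
Proof.
move=> F size_F.
have missed (T : finType) (h : 'Z_N * 'I_n.+1 -> T) : n < #|T| ->
    exists x, forall v, Some v \in F -> h v != x.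
  move=> nT; pose s := [seq h v | v <- pmap id F].
  have [x sx|s_all] := pickP [pred x | x \notin s].
    exists x => v Fv; apply: contraNneq sx => <-.
    by apply: map_f; rewrite mem_pmap map_id.
  have sT : #|T| <= size s.
    apply: leq_trans (card_size s); apply/subset_leq_card/subsetP => x _.
    by have := s_all x; rewrite inE => /negbFE.
  have sF : size s <= size F by rewrite size_map size_pmap count_size.
  by have := leq_trans nT (leq_trans sT (leq_trans sF size_F)); rewrite ltnn.
have [j0 Fj0] : exists j0 : 'I_n.+1, forall v, Some v \in F -> v.2 != j0.
  by apply: missed; rewrite card_ord.
have [i0 Fi0] : exists i0 : 'Z_N, forall v, Some v \in F -> v.1 != i0.
  by apply: missed; rewrite card_ord Zp_cast //; lia.
pose col (v : 'Z_N * 'I_n.+1) :=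
  if j0 < v.2 then odd v.2 else odd (val (v.1 - i0)%R).
(* The apex counts as layer [n.+1]. *)
exists (oapp col (odd n.+1)).
(* The parity fails to alternate only on the step into [i0], where the residue wraps around. *)
have step (i : 'Z_N) : (i + 1)%R != i0 ->
    odd (val (i + 1 - i0)%R) = ~~ odd (val (i - i0)%R).
  rewrite -subr_eq0 addrAC; move: (i - i0)%R => x; rewrite -val_eqE /=.
  rewrite (modn_small (isT : 1 < N)) addn1 => x1.
  have := ltn_ord x; rewrite [X in _ < X -> _]/= leq_eqVlt => /orP[/eqP xN|xN].
    by rewrite xN modnn in x1.
  by rewrite modn_small.
have edge (i i' : 'Z_N) (j j' : 'I_n.+1) :
    Some (i, j) \in F -> Some (i', j') \in F ->
    i' = (i + 1)%R ->
    [|| j' == j.+1 :> nat, j == j'.+1 :> nat |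
          (j == 0 :> nat) && (j' == 0 :> nat)] ->
    col (i, j) != col (i', j').
  move=> Fij Fij' i'E jj'; have := Fj0 _ Fij; have := Fj0 _ Fij'.
  rewrite /col /=; have := step i; rewrite -i'E (Fi0 _ Fij') => -> //.
  rewrite -!val_eqE /= => j'_j0 j_j0.
  (* As [j0] is missed, both ends lie on the same side of it. *)
  by case: (odd (i - i0)%R); case: ltnP => ?; case: ltnP => ?; lia.
have edge0 (i : 'Z_N) (j : 'I_n.+1) :
    Some (i, j) \in F -> j = n :> nat -> col (i, j) = odd n.
  move=> /Fj0; rewrite /col -val_eqE /= => jj0 jn.
  rewrite jn in jj0 *; case: ltnP => // n_j0; have := ltn_ord j0; lia.
move=> [[i j]|] [[i' j']|] //= Fp Fq.
- case/andP=> /orP[/eqP i'E|/eqP iE] jj'; first exact: edge.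
  by rewrite eq_sym; apply: edge => //; lia.
- by move=> /eqP /(edge0 _ _ Fp)->; case: (odd n).
- by move=> /eqP /(edge0 _ _ Fq)->; case: (odd n).
Qed.

End GeneralizedMycielskian.

Lemma locally_colourable_graph_exists k n : 3 <= k ->
  exists (V : finType) (E : rel V),
    [/\ irreflexive E, ~ colourable E k & locally_colourable E n k].
Proof.
elim: k => // k IHk; rewrite leq_eqVlt => /orP[/eqP<-|/IHk[V [E [Eirr nc lc]]]].
  exists _, (@mycielskian n); split; first exact: mycielskian_irreflexive.
    exact: mycielskian_not_colourable.
  apply: locally_bipartite_colourable; first exact: mycielskian_irreflexive.
    exact: mycielskian_symmetric.
  exact: mycielskian_locally_bipartite.
exists (option V), (cone E); split; first exact: cone_irreflexive.
  exact: cone_not_colourable.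
exact: cone_locally_colourable.
Qed.

Theorem theorem7p2 (k : nat) (hk : 3 <= k) : nonfinitely_based (Scstar k).
Proof.
apply: nonfinitely_based_Scstar => [|n]; first by lia.
exact: locally_colourable_graph_exists.
Qed.
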